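(* Let $S$ be a finite subset of $\mathbb{N}=\{1,2,3,\dots\}$. The following are equivalent: (1) there exist finite digraphs $G$, $H$ such that $S=FF(G,H)$; (2) there is a finite set $T\subset\mathbb{N}$ such that $S=\{s\in\mathbb{N}: \exists t\in T,\ s\mid t\}$.
   Context: Digraphs are finite multidigraphs; loops and parallel edges are allowed. For an abelian group $M$, a map $\varphi:E(G)\to M$ is an $M$-flow if at every vertex $v$ the sum of $\varphi$ over edges leaving $v$ equals the sum of $\varphi$ over edges entering $v$. A mapping $f:E(G)\to E(H)$ is $M$-flow-continuous if for every $M$-flow $\varphi$ on $H$ the composition $\varphi\circ f$ is an $M$-flow on $G$. We set $FF(G,H)=\{n\ge 1: \text{there is a } \mathbb{Z}_n\text{-flow-continuous mapping } f:E(G)\to E(H)\}$. *)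

(* Defs.v *)
From mathcomp Require Import all_boot all_algebra.
From mathcomp Require Import all_classical.

Set Implicit Arguments.
Unset Strict Implicit.
Unset Printing Implicit Defensive.

Import GRing.Theory.
Local Open Scope classical_set_scope.
Local Open Scope ring_scope.

Record digraph := Digraph {
  vertex : finType;
  edge : finType;
  src : edge -> vertex;
  tgt : edge -> vertex
}.

Definition is_flow (M : zmodType) (G : digraph) (phi : edge G -> M) : Prop :=
  forall v : vertex G,
    \sum_(e : edge G | src e == v) phi e = \sum_(e : edge G | tgt e == v) phi e.

Definition flow_continuous (M : zmodType) (G H : digraph)
    (f : edge G -> edge H) : Prop :=
  forall phi : edge H -> M, is_flow phi -> is_flow (phi \o f).

(* The additive group of integers modulo n, for every n >= 1.  We do not use
   'Z_n, since 'Z_1 is Z/2Z; 'I_1 is the trivial group.  The value at n = 0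
   is junk. *)
Definition Zmod (n : nat) : zmodType := 'I_(n.-1.+1).

Definition FF (G H : digraph) : set nat :=
  [set n | (1 <= n)%N /\
           exists f : edge G -> edge H, flow_continuous (Zmod n) f].

(* Main.v *)
(* FF(G, H) is closed under divisors because Z_s embeds into Z_n whenever s
   divides n; this gives (1) => (2) with T = S.  For (2) => (1), let e be the
   product of T and d = 2e + 1.  Let G consist of two dipoles (families of
   parallel edges) with e and d edges, and H of one dipole with d - t edges for
   each t in T.  A mapping is Z_n-flow-continuous exactly when, for each dipole
   of G, the numbers of its edges mapped to two parallel edges of H are congruent
   modulo n.  The e-dipole is too small to cover a dipole of H, so some of these
   numbers vanish in each dipole of H, and n divides e.  The d-dipole can cover
   at most one dipole of H: if it covers none, then n divides d, and n = 1 since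
   d is coprime to e; if it covers the one with d - t edges, then each of these
   edges is hit a number of times congruent to 1, and n divides t.  Conversely,
   if n divides t, map d - t edges bijectively and all other edges to a single
   edge. *)
Require Import Defs.
From mathcomp Require Import all_boot all_algebra.
From mathcomp Require Import all_classical.
From mathcomp Require Import zify.

Set Implicit Arguments.
Unset Strict Implicit.
Unset Printing Implicit Defensive.

Import GRing.Theory.

Local Open Scope classical_set_scope.

(** * Residues modulo [n] *)

Definition Zmod_val (n : nat) (a : Zmod n) : nat := (a : 'I_n.-1.+1).

Definition Zmod_of (n m : nat) : Zmod n := (inZp m : 'I_n.-1.+1).

Lemma Zmod_val_inj (n : nat) : injective (@Zmod_val n).
Proof. exact: val_inj. Qed.

Lemma Zmod_val_lt (n : nat) (a : Zmod n) : 0 < n -> Zmod_val a < n.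
Proof. by case: n a => // n a _; apply: (ltn_ord (a : 'I_n.+1)). Qed.

Lemma Zmod_ofK (n m : nat) : 0 < n -> Zmod_val (Zmod_of n m) = m %% n.
Proof. by case: n. Qed.

Lemma Zmod_valD (n : nat) (a b : Zmod n) : 0 < n ->
  Zmod_val (a + b)%R = (Zmod_val a + Zmod_val b) %% n.
Proof. by case: n a b. Qed.

Lemma Zmod_val_mulrn (n m : nat) (a : Zmod n) : 0 < n ->
  Zmod_val (a *+ m)%R = (Zmod_val a * m) %% n.
Proof.
move=> n0; elim: m => [|m IHm].
  by rewrite mulr0n muln0 mod0n; case: n n0 a.
by rewrite mulrS Zmod_valD // IHm modnDmr mulnS.
Qed.

Lemma Zmod_mulrn_dvd (n m : nat) (a : Zmod n) :
  0 < n -> n %| m -> (a *+ m = 0)%R.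
Proof.
move=> n0 nm; apply: Zmod_val_inj; rewrite -(mulr0n a) !Zmod_val_mulrn // muln0.
by rewrite mod0n; apply/eqP/dvdn_mull.
Qed.

Lemma Zmod_one_mulrn_inj (n p q : nat) : 0 < n ->
  (Zmod_of n 1 *+ p = Zmod_of n 1 *+ q)%R -> p = q %[mod n].
Proof.
move=> n0 /(congr1 (@Zmod_val n)); rewrite !Zmod_val_mulrn // Zmod_ofK //.
by rewrite !modnMml !mul1n.
Qed.

(** * Closure under divisors *)

Definition Zmod_scale (s n : nat) (a : Zmod s) : Zmod n :=
  Zmod_of n (Zmod_val a * (n %/ s)).

(** Multiplying by [n %/ s] turns reduction modulo [s] into reduction modulo [n]. *)
Lemma Zmod_scaleD (s n : nat) : 0 < n -> s %| n ->
  {morph @Zmod_scale s n : a b / (a + b)%R >-> (a + b)%R}.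
Proof.
move=> n0 sn a b; have s0 := dvdn_gt0 n0 sn; apply: Zmod_val_inj.
rewrite Zmod_valD // !Zmod_ofK // Zmod_valD // modnDm -mulnDl.
by rewrite muln_modl [s * _]mulnC divnK // modn_mod.
Qed.

Lemma Zmod_scale_inj (s n : nat) : 0 < n -> s %| n ->
  injective (@Zmod_scale s n).
Proof.
move=> n0 sn a b; have s0 := dvdn_gt0 n0 sn.
move=> /(congr1 (@Zmod_val n)); rewrite !Zmod_ofK // => eq_ab.
have q0 : 0 < n %/ s by rewrite divn_gt0 // dvdn_leq.
have small (c : Zmod s) : Zmod_val c * (n %/ s) < n.
  by rewrite -[ltnRHS](divnK sn) mulnC ltn_pmul2l // Zmod_val_lt.
move: eq_ab; rewrite !modn_small // => /eqP; rewrite eqn_pmul2r // => /eqP.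
exact: Zmod_val_inj.
Qed.

(** Scaling turns a flow over [Zmod s] into one over [Zmod n]; injectivity brings the balance of its
    pullback back to [Zmod s]. *)
Lemma flow_continuous_dvd (G H : digraph) (f : edge G -> edge H) (s n : nat) :
  0 < n -> s %| n -> flow_continuous (Zmod n) f -> flow_continuous (Zmod s) f.
Proof.
move=> n0 sn fn phi phi_flow v.
have scaleD := Zmod_scaleD n0 sn.
have scale0 : Zmod_scale n (0 : Zmod s)%R = 0%R.
  by apply/(addrI (Zmod_scale n (0 : Zmod s)%R)); rewrite -scaleD !addr0.
have scale_sum := big_morph _ scaleD scale0.
apply: (Zmod_scale_inj n0 sn); rewrite !scale_sum.
by apply: (fn (@Zmod_scale s n \o phi)) => u; rewrite -!scale_sum phi_flow.
Qed.

(** * Flows on disjoint unions of dipoles *)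

Definition dipoles (I : finType) (k : I -> nat) : digraph :=
  @Digraph (I * bool)%type {i : I & 'I_(k i)}
    (fun x => (tag x, false)) (fun x => (tag x, true)).

(** Every vertex is a pure source or a pure sink, so one side of its balance is an empty sum. *)
Lemma is_flow_dipolesP (M : zmodType) (I : finType) (k : I -> nat)
    (phi : edge (dipoles k) -> M) :
  is_flow phi <->
  forall i, (\sum_(j < k i) phi (Tagged (fun i => 'I_(k i)) j) = 0)%R.
Proof.
have sum_tag i : (\sum_(j < k i) phi (Tagged (fun i => 'I_(k i)) j)
    = \sum_(x : edge (dipoles k) | tag x == i) phi x)%R.
  transitivity (\sum_(i' | i' == i) \sum_(j < k i')
      phi (Tagged (fun i => 'I_(k i)) j))%R; first by rewrite big_pred1_eq.
  rewrite sig_big_dep /=; apply: eq_big => [[i' j]|[i' j] _] //=.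
  by rewrite andbT.
have src_tag i b (x : edge (dipoles k)) :
  (src x == (i, b)) = ~~ b && (tag x == i) by rewrite xpair_eqE andbC; case: b.
have tgt_tag i b (x : edge (dipoles k)) :
  (tgt x == (i, b)) = b && (tag x == i) by rewrite xpair_eqE andbC; case: b.
split=> [flow i|sum0 [i b]].
  rewrite sum_tag; have := flow (i, false).
  under eq_bigl do rewrite src_tag; under [RHS]eq_bigl do rewrite tgt_tag.
  by rewrite /= big_pred0_eq.
under eq_bigl do rewrite src_tag; under [RHS]eq_bigl do rewrite tgt_tag.
by case: b; rewrite /= -sum_tag sum0 big_pred0_eq.
Qed.

(** * Sums of numbers congruent modulo [n] *)

Lemma dvdn_sum_congruent (n k : nat) (F : 'I_k -> nat) (j0 : 'I_k) :
  (forall i j, F i = F j %[mod n]) -> F j0 = 0 -> n %| \sum_j F j.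
Proof.
move=> FF F0; apply: dvdn_sum => j _.
by rewrite /dvdn (FF j j0) F0 mod0n.
Qed.

(** With a sum below [k], some of the [k] terms must vanish. *)
Lemma dvdn_sum_congruent_small (n k : nat) (F : 'I_k -> nat) :
  (forall i j, F i = F j %[mod n]) -> \sum_j F j < k -> n %| \sum_j F j.
Proof.
move=> FF Fk; case: (pickP (fun j => F j == 0)) => [j /eqP F0|Fn0].
  exact: dvdn_sum_congruent F0.
suff : k <= \sum_j F j by rewrite leqNgt Fk.
rewrite -[leqLHS]card_ord -sum1_card; apply: leq_sum => j _.
by rewrite lt0n Fn0.
Qed.

(** If no term vanishes, lowering each by 1 keeps the congruences and brings the sum below [k]. *)
Lemma dvdn_sum_congruent_double (n k : nat) (F : 'I_k -> nat) :
  (forall i j, F i = F j %[mod n]) -> \sum_j F j < k.*2 ->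
  n %| \sum_j F j \/ k <= \sum_j F j /\ n %| \sum_j F j - k.
Proof.
move=> FF Fk; case: (pickP (fun j => F j == 0)) => [j /eqP F0|Fn0].
  by left; apply: dvdn_sum_congruent F0.
right; have FE : \sum_j F j = \sum_j (F j).-1 + k.
  rewrite -[X in _ + X]card_ord -sum1_card -big_split; apply: eq_bigr => j _ /=.
  by rewrite addn1 prednK // lt0n Fn0.
rewrite FE leq_addl addnK; split=> //; apply: dvdn_sum_congruent_small.
  move=> i j; apply/eqP; rewrite -(eqn_modDr 1) !addn1 !prednK ?lt0n ?Fn0 //.
  exact/eqP.
by rewrite -(ltn_add2r k) -FE addnn.
Qed.

(** * Counting edges mapped between dipoles *)

Section Fibers.

Variables (I J : finType) (k : I -> nat) (l : J -> nat).
Variable f : edge (dipoles k) -> edge (dipoles l).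

Definition fiber (i : I) (y : edge (dipoles l)) : nat :=
  \sum_(j < k i) (f (Tagged (fun i => 'I_(k i)) j) == y).

(** This counts the edges of dipole [i] that land in dipole [j]. *)
Definition block (i : I) (j : J) : nat :=
  \sum_(y < l j) fiber i (Tagged (fun j => 'I_(l j)) y).

Lemma sum_block (i : I) : \sum_j block i j = k i.
Proof.
rewrite sig_big_dep /= exchange_big /= -[RHS]card_ord -sum1_card.
apply: eq_bigr => x _; case: (f _) => j y.
rewrite (bigD1 (Tagged (fun j => 'I_(l j)) y)) //=.
rewrite eqxx big1 // => -[j' y'] /=.
by rewrite eq_sym => /negPf ->.
Qed.

(** Test [f] on the flow sending 1 along [x] and back along the parallel edge [y]. *)
Lemma fiber_congruent (n : nat) (i : I) (j : J) (x y : 'I_(l j)) : 0 < n ->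
  flow_continuous (Zmod n) f ->
  fiber i (Tagged (fun j => 'I_(l j)) x) =
  fiber i (Tagged (fun j => 'I_(l j)) y) %[mod n].
Proof.
move=> n0 fn; apply: Zmod_one_mulrn_inj => //.
pose g : Zmod n := Zmod_of n 1.
pose X : edge (dipoles l) := Tagged (fun j => 'I_(l j)) x.
pose Y : edge (dipoles l) := Tagged (fun j => 'I_(l j)) y.
pose phi (z : edge (dipoles l)) : Zmod n := (g *+ (z == X) - g *+ (z == Y))%R.
have phi_flow : is_flow phi.
  apply/is_flow_dipolesP => j'; rewrite sumrB !sumrMnr.
  suff sumj (z : 'I_(l j)) : \sum_(w < l j') (Tagged (fun j => 'I_(l j)) w
      == Tagged (fun j => 'I_(l j)) z :> edge (dipoles l)) = (j' == j).
    by rewrite !sumj subrr.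
  case: (eqVneq j' j) => [->|jj'].
    rewrite (bigD1 z) //= eqxx big1 // => w wz.
    by rewrite eq_Tagged /= (negPf wz).
  rewrite big1 // => w _; case: eqP => // /(congr1 tag) /= jj.
  by rewrite jj eqxx in jj'.
have /is_flow_dipolesP/(_ i) := fn phi phi_flow.
by rewrite sumrB !sumrMnr => /eqP; rewrite subr_eq0 => /eqP.
Qed.

Lemma dvdn_block_small (n : nat) (i : I) (j : J) : 0 < n ->
  flow_continuous (Zmod n) f -> block i j < l j -> n %| block i j.
Proof.
move=> n0 fn; apply: dvdn_sum_congruent_small => x y; exact: fiber_congruent.
Qed.

Lemma dvdn_block_double (n : nat) (i : I) (j : J) : 0 < n ->
  flow_continuous (Zmod n) f -> block i j < (l j).*2 ->
  n %| block i j \/ l j <= block i j /\ n %| block i j - l j.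
Proof.
move=> n0 fn; apply: dvdn_sum_congruent_double => x y; exact: fiber_congruent.
Qed.

Lemma leq_block (i : I) (j : J) : block i j <= k i.
Proof. by rewrite -sum_block (bigD1 j) //= leq_addr. Qed.

Lemma leq_block2 (i : I) (j j' : J) : j' != j -> block i j + block i j' <= k i.
Proof.
by move=> jj'; rewrite -sum_block (bigD1 j) //= (bigD1 j') //= addnA leq_addr.
Qed.

Lemma dvdn_dipole_small (n : nat) (i : I) : 0 < n ->
  flow_continuous (Zmod n) f -> (forall j, k i < l j) -> n %| k i.
Proof.
move=> n0 fn kl; rewrite -sum_block; apply: dvdn_sum => j _.
by apply: dvdn_block_small => //; apply: leq_ltn_trans (kl j); apply: leq_block.
Qed.

Lemma dvdn_dipole_double (n : nat) (i : I) : 0 < n ->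
  flow_continuous (Zmod n) f -> (forall j j', k i < l j + l j') ->
  n %| k i \/ exists2 j, l j <= k i & n %| k i - l j.
Proof.
move=> n0 fn kl.
case: (pickP (fun j => ~~ (n %| block i j))) => [j nj|nblock]; last first.
  left; rewrite -sum_block; apply: dvdn_sum => j _.
  by have /negbT := nblock j; rewrite negbK.
have [njF|[lj nlj]] : n %| block i j \/ l j <= block i j /\ n %| block i j - l j.
- apply: dvdn_block_double => //; rewrite -addnn.
  by apply: leq_ltn_trans (kl j j); apply: leq_block.
- by rewrite njF in nj.
have ljk : l j <= k i by apply: leq_trans lj (leq_block i j).
right; exists j => //.
have -> : k i - l j = (block i j - l j) + \sum_(j' | j' != j) block i j'.
  by rewrite -[in LHS](sum_block i) (bigD1 j) //= addnBAC.
apply: dvdn_add => //; apply: dvdn_sum => j' jj'.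
apply: dvdn_block_small => //.
(* Dipole [j] already takes at least [l j] edges, so fewer than [l j'] remain for [j']. *)
have := leq_block2 i jj'; have := kl j j'; lia.
Qed.

End Fibers.

(** * Realizing sets of divisors by dipoles *)

Lemma flow_continuous_dipoles (I J : finType) (k : I -> nat) (l : J -> nat)
    (n : nat) (j : J) :
  0 < n -> 0 < l j ->
  (forall i, n %| k i \/ l j <= k i /\ n %| k i - l j) ->
  exists f : edge (dipoles k) -> edge (dipoles l), flow_continuous (Zmod n) f.
Proof.
move=> n0 lj kl.
pose y0 : 'I_(l j) := Ordinal lj.
(* The default of [insubd] sends all edges of index at least [l j] to [y0]; their number is a
   multiple of [n]. *)
pose h (x : edge (dipoles k)) : 'I_(l j) :=
  if n %| k (tag x) then y0 else insubd y0 (val (tagged x)).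
exists (fun x => Tagged (fun j => 'I_(l j)) (h x)) => phi /is_flow_dipolesP phi0.
apply/is_flow_dipolesP => i; rewrite /comp /h.
have [nk|nk] := boolP (n %| k i).
  by rewrite sumr_const card_ord Zmod_mulrn_dvd.
have [kF|[lk nkl]] := kl i; first by rewrite kF in nk.
pose F m := phi (Tagged (fun j => 'I_(l j)) (insubd y0 m)).
rewrite -(big_mkord xpredT F) (big_cat_nat (n := l j)) //=.
rewrite [X in (_ + X)%R](eq_big_nat _ _
    (F2 := fun=> phi (Tagged (fun j => 'I_(l j)) y0))); last first.
  move=> m /andP[lm _]; rewrite /F; congr (phi (Tagged _ _)); apply/val_inj.
  by rewrite val_insubd ltnNge lm.
rewrite sumr_const_nat Zmod_mulrn_dvd // addr0 big_mkord -[RHS](phi0 j).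
by apply: eq_bigr => m _; rewrite /F valKd.
Qed.

Theorem theorem2p9 (S : set nat) (finS : finite_set S)
    (posS : S `<=` [set n | (1 <= n)%N]) :
  (exists G H : digraph, S = FF G H) <->
  (exists T : set nat,
     [/\ finite_set T, T `<=` [set n | (1 <= n)%N] &
         S = [set s | (1 <= s)%N /\ exists2 t, T t & (s %| t)%N]]).
Proof.
split=> [[G [H SE]]|[T [/finite_seqP[ts ->] ts_pos ->]]].
  exists S; split=> //; apply/seteqP; split=> [s Ss|s [s0 [t]]].
    by split; [exact: posS|exists s].
  rewrite SE => -[t0 [f ft]] st; split=> //; exists f.
  exact: flow_continuous_dvd ft.
pose e := \prod_(t <- ts) t; pose d := e.*2.+1.
have e0 : 0 < e.
  by rewrite /e big_seq; apply: prodn_cond_gt0 => t; apply: ts_pos.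
have ts_dvd t : t \in ts -> t %| e.
  by move=> tts; rewrite /e (big_rem t) //= dvdn_mulr.
have ts_le t : t \in ts -> t <= e by move=> /ts_dvd; apply: dvdn_leq.
pose k b := if b then d else e.
pose l (t : seq_sub ts) := d - val t.
(* Since [t <= e], at least [e.+1] of the [e.*2.+1] edges remain, so any two dipoles of the target
   together exceed [d]. *)
have l_gt t : e < l t by have := ts_le _ (valP t); rewrite /l /d; lia.
have dBl t : d - l t = val t by have := ts_le _ (valP t); rewrite /l /d; lia.
exists (dipoles k), (dipoles l); apply/seteqP; split=> n [n0].
  move=> [t tts nt]; split=> //; pose t' : seq_sub ts := SeqSub tts.
  apply: (@flow_continuous_dipoles _ _ k l n t') => //.
    exact: leq_ltn_trans (l_gt t').
  case; last by left; apply: dvdn_trans nt (ts_dvd _ tts).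
  by right; rewrite /k dBl; split=> //; apply: leq_subr.
move=> [f fn]; split=> //.
have ne : n %| e by apply: (dvdn_dipole_small (i := false) n0 fn).
have [nd|[t _]] : n %| d \/ exists2 t, l t <= d & n %| d - l t.
- apply: (dvdn_dipole_double (i := true) n0 fn) => t t'.
  by have := l_gt t; have := l_gt t'; rewrite /k /d; lia.
(* Here [n] is 1, but an element of [ts] is still needed: the image of an edge of the nonempty
   [e]-dipole supplies it. *)
- pose t := tag (f (Tagged (fun b => 'I_(k b)) (Ordinal e0 : 'I_(k false)))).
  exists (val t); first exact: valP.
  have : n %| 1 by rewrite -(dvdn_addr (m := e.*2)) ?addn1 // -muln2 dvdn_mulr.
  by rewrite dvdn1 => /eqP ->.
- by rewrite dBl => nt; exists (val t) => //; apply: valP.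
Qed.
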